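(* For every integer capacity $B\ge 1$ there exists an instance of the Asymmetric Trading Prophets (ATP) problem with capacity $B$ and initial inventory $B_0=0$ such that the optimal offline algorithm achieves an expected profit strictly greater than $0$, while no online algorithm achieves an expected profit greater than $0$.
   Context: ATP problem. A decision maker interacts with $T$ sequentially arriving requests to trade copies of a product. She has capacity $B\ge 1$ (she may hold at most $B$ copies at any time) and starts with an initial inventory of $B_0\in\{0,\dots,B\}$ copies. It is assumed throughout that $T\ge B_0$ and $B\le B_0+T$. At time $t\in\{1,\dots,T\}$ a price tuple $(b_t,s_t)$ is revealed, with $b_t\in[0,+\infty]$ (the cost of buying a copy; $b_t=+\infty$ means buying is impossible) and $s_t\in[0,\infty)$ (the revenue from selling a copy); $(b_t,s_t)$ is drawn from a known distribution $\mathcal D_t$, independently across $t$, while $b_t$ and $s_t$ may be arbitrarily correlated with each other. At time $t$ she takes exactly one action: Buy one copy at price $b_t$ (allowed if she holds at most $B-1$ copies), Sell one copy at price $s_t$ (allowed if she holds at least one copy), or Skip. Profit is total revenue from sales minus total cost of purchases. An online algorithm (possibly randomized) chooses its action at time $t$ knowing only the distributions, the tuples revealed up to and including time $t$, and its past actions. The optimal offline algorithm knows all realized tuples in advance and attains the maximum possible profit for each realization; its expected profit is the expectation of this maximum. *)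

(* Defs.v *)
From HB Require Import structures.
From mathcomp Require Import all_boot all_order all_algebra.
From mathcomp Require Import all_classical all_reals all_analysis.
From mathcomp Require Import measurable_realfun.

Set Implicit Arguments.
Unset Strict Implicit.
Unset Printing Implicit Defensive.

Import Order.TTheory GRing.Theory Num.Theory.
Local Open Scope classical_set_scope.
Local Open Scope ring_scope.

Inductive action := Buy | Sell | Skip.

Definition action_code (a : action) : option bool :=
  match a with Buy => Some true | Sell => Some false | Skip => None end.

Definition action_decode (o : option bool) : action :=
  match o with Some true => Buy | Some false => Sell | None => Skip end.

Lemma action_codeK : cancel action_code action_decode.
Proof. by case. Qed.

HB.instance Definition _ := Finite.copy action (can_type action_codeK).

(* A price tuple (b, s); [b = +oo] means that buying is impossible. *)
Notation price R := (\bar R * R)%type.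

Definition valid_price (R : realType) (p : price R) : Prop :=
  (0 <= p.1)%E /\ 0 <= p.2.

(* [k] is the inventory held before the first action of [a]. *)
Fixpoint feasible (R : realType) (B k : nat) (x : seq (price R))
    (a : seq action) : bool :=
  match x, a with
  | [::], [::] => true
  | p :: x', Buy :: a' => [&& (k < B)%N, p.1 != +oo%E & feasible B k.+1 x' a']
  | _ :: x', Sell :: a' => (0 < k)%N && feasible B k.-1 x' a'
  | _ :: x', Skip :: a' => feasible B k x' a'
  | _, _ => false
  end.

Definition gain (R : realType) (p : price R) (a : action) : R :=
  match a with Buy => - fine p.1 | Sell => p.2 | Skip => 0 end.

Definition profit (R : realType) (T : nat) (x : T.-tuple (price R))
    (a : T.-tuple action) : R :=
  \sum_(t < T) gain (tnth x t) (tnth a t).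

(* [joint] is the law of the whole price sequence. Independence across time is
   the product rule on measurable rectangles; as these form a pi-system
   generating the sigma-algebra of [horizon.-tuple (price R)], [joint] is the
   product of the [law t] and is determined by them. *)
Record ATP (R : realType) := MkATP {
  horizon : nat;
  capacity : nat;
  stock0 : nat;
  law : 'I_horizon -> probability (price R) R;
  joint : probability (horizon.-tuple (price R)) R;
  capacity_ge1 : (1 <= capacity)%N;
  stock0_le_capacity : (stock0 <= capacity)%N;
  stock0_le_horizon : (stock0 <= horizon)%N;
  capacity_le : (capacity <= stock0 + horizon)%N;
  law_valid : forall t, law t [set p | valid_price p] = 1%E;
  joint_indep : forall A : 'I_horizon -> set (price R),
    (forall t, measurable (A t)) ->
    joint [set x | forall t, A t (tnth x t)] = (\prod_(t < horizon) law t (A t))%E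
}.

(* Never trading is always feasible and has profit [0], so the default value
   [0] of the maximum is attained. *)
Definition offline_profit (R : realType) (I : ATP R)
    (x : (horizon I).-tuple (price R)) : R :=
  \big[Num.max/0]_(a : (horizon I).-tuple action
                   | feasible (capacity I) (stock0 I) x a) profit x a.

Definition offline_expected_profit (R : realType) (I : ATP R) : \bar R :=
  'E_(joint I)[@offline_profit R I].

(* Decision at (0-based) time [t], from the random seed in [S], the [t.+1] price
   tuples revealed so far and the [t] past actions. *)
Definition policy (R : realType) (S : Type) :=
  forall t : nat, S -> t.+1.-tuple (price R) -> t.-tuple action -> action.

Fixpoint play (R : realType) (S : Type) (f : policy R S) (u : S)
    (x : nat -> price R) (n : nat) : n.-tuple action :=
  match n with
  | 0 => [tuple]
  | k.+1 => let h := play f u x k in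
            rcons_tuple h (f k u [tuple x i | i < k.+1] h)
  end.

(* The actions over the whole horizon; the default of [nth] is never read. *)
Definition run (R : realType) (S : Type) (f : policy R S) (u : S) (T : nat)
    (x : T.-tuple (price R)) : T.-tuple action :=
  play f u (nth (+oo%E, 0) x) T.

Record online_algorithm (R : realType) (I : ATP R) (d : measure_display)
    (S : measurableType d) := MkOnline {
  decide :> policy R S;
  decide_measurable : forall (t : nat) (h : t.-tuple action) (a : action),
    (t < horizon I)%N ->
    measurable [set ux : S * t.+1.-tuple (price R) | decide ux.1 ux.2 h = a];
  decide_feasible : forall (u : S) (x : (horizon I).-tuple (price R)),
    (forall t, valid_price (tnth x t)) ->
    feasible (capacity I) (stock0 I) x (run decide u x)
}.

(* The seed has law [mu] and is independent of the prices. When the expectation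
   is undefined (positive and negative parts both infinite), the library's value
   is [-oo]. *)
Definition online_expected_profit (R : realType) (I : ATP R)
    (d : measure_display) (S : measurableType d) (mu : probability S R)
    (f : online_algorithm I S) : \bar R :=
  'E_(mu \x joint I)%E[fun ux => profit ux.2 (run f ux.1 ux.2)].

(* Main.v *)
(* A copy costs 1 at time 0 and can then only be sold at time 1, for 2 or 0 with
   probability 1/2 each. Knowing the coin, one buys only before a good sale and
   earns 1/2 on average; an online buyer pays 1 for a sale worth 1 on average. *)
Require Import Defs.
From mathcomp Require Import all_boot all_order all_algebra.
From mathcomp Require Import all_classical all_reals all_analysis.
From mathcomp Require Import measurable_realfun.
From HB Require Import structures.

Set Implicit Arguments.
Unset Strict Implicit.
Unset Printing Implicit Defensive.

Import Order.TTheory GRing.Theory Num.Theory.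
Local Open Scope classical_set_scope.
Local Open Scope ring_scope.

(** * Integral bounds from pointwise bounds *)

Section monotone_integral.
Context d (T : measurableType d) (R : realType).
Variable (mu : {measure set T -> \bar R}).
Local Open Scope ereal_scope.

(* The integral of a nonnegative function is a supremum over the simple functions
   below it, so it is monotone even on non-measurable functions. This avoids
   proving that the run of an online algorithm is measurable. *)
Lemma ge0_le_integralT (f g : T -> \bar R) :
  (forall x, 0 <= f x) -> (forall x, f x <= g x) ->
  \int[mu]_x f x <= \int[mu]_x g x.
Proof.
move=> f0 fg; have g0 x : 0 <= g x := le_trans (f0 x) (fg x).
rewrite !ge0_integralTE//; apply: ereal_sup_le => _ [h /= hf <-].
by exists h => // x; exact: le_trans (hf x) (fg x).
Qed.

Lemma integral_indicT (A : set T) :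
  measurable A -> \int[mu]_x (\1_A x)%:E = mu A.
Proof. by move=> mA; rewrite integral_indic// setIT. Qed.

(** The positive part of [f] is at most the indicator of [C] plus [+oo] on [N], which integrates to
    [mu C] since [N] is null. The negative part is at least the indicator of [D]. *)
Lemma integral_le_measureB (f : T -> \bar R) (C D N : set T) :
  measurable C -> measurable D -> measurable N -> mu N = 0 ->
  {in C, forall x, f x <= 1} -> {in D, forall x, f x <= -1} ->
  (forall x, x \notin C -> x \notin D -> x \notin N -> f x <= 0) ->
  \int[mu]_x f x <= mu C - mu D.
Proof.
move=> mC mD mN N0 fC fD f0; rewrite integralE.
have oo_ge0 x : 0 <= ((cst +oo : T -> \bar R) \_ N) x
    by rewrite patchE; case: ifP => _; rewrite ?leey.
apply: leeB.
  have -> : mu C = \int[mu]_x ((\1_C x)%:E + ((cst +oo) \_ N) x).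
    rewrite ge0_integralD//; last 2 first.
    - by apply/measurable_EFinP; exact: measurable_indic.
    - exact/(measurable_restrictT _ mN).
    by rewrite integral_indicT// -integral_mkcond integral_cst// N0 mule0
      adde0.
  apply: ge0_le_integralT => // x; rewrite funeposE ge_max.
  apply/andP; split; last first.
    by rewrite adde_ge0// lee_fin.
  rewrite patchE; have [_|xN] := boolP (x \in N).
    by rewrite addey ?leey.
  rewrite adde0 indicE; have [/fC //|xC] := boolP (x \in C).
  have [/fD fx|xD] := boolP (x \in D).
    by apply: le_trans fx _; rewrite lee_fin oppr_le0.
  exact: f0.
rewrite -(integral_indicT mD).
apply: ge0_le_integralT => [x|x]; first by rewrite lee_fin.
rewrite indicE funenegE; have [/fD fx|_] := boolP (x \in D).
  by rewrite le_max leeNr fx.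
by rewrite le_max lexx orbT.
Qed.

End monotone_integral.

(** * Runs of a policy and feasible action sequences *)

Section play.
Context (R : realType) (S : Type) (f : policy R S) (u : S).

(** Later steps only append to the history, so entry [k] stays the decision made at time [k]. *)
Lemma nth_play (x : nat -> price R) n k : (k < n)%N ->
  nth Skip (play f u x n) k = @f k u [tuple x i | i < k.+1] (play f u x k).
Proof.
elim: n => // n IHn; rewrite ltnS leq_eqVlt /= nth_rcons size_tuple.
by case/predU1P => [->|kn]; [rewrite ltnn eqxx | rewrite kn IHn].
Qed.

End play.

Section feasible.
Context (R : realType).

Lemma feasible_Buy B k (x : seq (price R)) (a : seq action) p0 a0 t :
  feasible B k x a -> (t < size x)%N -> nth a0 a t = Buy ->
  (nth p0 x t).1 != +oo%E.
Proof.
elim: x a k t => [|p x IHx] [|[] a] k [|t] //=.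
- by case/and3P.
- by case/and3P => _ _ /IHx/[apply].
- by case/andP => _ /IHx/[apply].
- by move=> /IHx/[apply].
Qed.

Lemma feasible_Skip B k (x : seq (price R)) :
  feasible B k x (nseq (size x) Skip).
Proof. by elim: x. Qed.

End feasible.

(** * The coin instance and its independence *)

Section instance.
Context (R : realType).

(* The steps after time 1 are idle: they only make the horizon at least [B]. *)
Definition coin_price (t : nat) (b : bool) : price R :=
  (if t == 0%N then 1%E else +oo%E, if (t == 1%N) && b then 2 else 0).

Definition coin_prices T (b : bool) : T.-tuple (price R) :=
  [tuple coin_price t b | t < T].

(** Every subset of [bool] is measurable; hence the price maps are random variables and the coin can
    be pushed forward along them. *)
Let mbool d (U : measurableType d) (f : bool -> U) :
  measurable_fun [set: bool] f.
Proof. by []. Qed.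

HB.instance Definition _ t :=
  @isMeasurableFun.Build _ _ _ _ (coin_price t) (mbool _).
HB.instance Definition _ T :=
  @isMeasurableFun.Build _ _ _ _ (coin_prices T) (mbool _).

Local Notation coin := (bernoulli_prob (2^-1 : R)).

Lemma coinE (A : set bool) :
  coin A = ((2^-1)%:E * \d_true A + (2^-1)%:E * \d_false A)%E.
Proof.
have half01 : 0 <= (2^-1 : R) <= 1 by rewrite invr_ge0 ler0n invf_le1 ?ler1n.
rewrite bernoulli_probE//; congr (_ + _%:E * _)%E.
by rewrite /unstable.onem [X in X - _](splitr 1) mul1r addrK.
Qed.

Definition coin_law T (t : 'I_T) : probability (price R) R :=
  distribution coin (coin_price t).

(** One coin drives all times, but only the price at time 1 reads it. *)
Definition coin_joint T : probability (T.-tuple (price R)) R :=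
  distribution coin (coin_prices T).

Lemma coin_price_valid t b : valid_price (coin_price t b).
Proof. by split => /=; case: ifP => // _; rewrite ?lee_fin ?leey. Qed.

Lemma coin_law_valid T (t : 'I_T) : coin_law t [set p | valid_price p] = 1%E.
Proof.
rewrite -(probability_setT coin) /coin_law /distribution /pushforward /=.
congr (bernoulli_prob _ _); apply/seteqP; split => // b _.
exact: coin_price_valid.
Qed.

(** Away from time 1 the prices are constant, so each of these factors is 0 or 1. If all are 1, both
    sides are the probability at time 1; if one is 0, both sides vanish. *)
Lemma coin_joint_indep n (A : 'I_n.+2 -> set (price R)) :
    (forall t, measurable (A t)) ->
  coin_joint n.+2 [set x | forall t, A t (tnth x t)] =
  (\prod_(t < n.+2) coin_law t (A t))%E.
Proof.
move=> _; pose t1 : 'I_n.+2 := lift ord0 ord0.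
have constant t b : t != t1 -> coin_price t b = coin_price t true.
  move=> tt1; rewrite /coin_price; suff /negbTE -> : t != 1%N :> nat by [].
  by apply: contraNN tt1 => /eqP tE; apply/eqP/val_inj.
rewrite (bigD1 t1)//= /coin_joint /coin_law /distribution /pushforward.
have [h|/existsNP[t /not_implyP[tt1 h]]] :=
    pselect (forall t, t != t1 -> A t (coin_price t true)).
  rewrite [X in (_ * X)%E]big1 ?mule1 => [|t tt1].
    congr (bernoulli_prob _ _); apply/seteqP; split => b /=.
      by move=> /(_ t1); rewrite tnth_mktuple.
    move=> At1 t; rewrite tnth_mktuple; have [->//|tt1] := eqVneq t t1.
    by rewrite constant//; exact: h.
  rewrite -(probability_setT coin); congr (bernoulli_prob _ _).
  by apply/seteqP; split => // b _ /=; rewrite constant//; exact: h.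
rewrite (bigD1 t)//= [X in _ = (_ * (X * _))%E](_ : _ = 0%E) ?mul0e ?mule0.
  rewrite -(measure0 coin); congr (bernoulli_prob _ _).
  apply/seteqP; split => // b /= /(_ t); rewrite tnth_mktuple constant//.
rewrite -(measure0 coin); congr (bernoulli_prob _ _).
by apply/seteqP; split => // b /=; rewrite constant.
Qed.

(** * Profit and probability of the two price sequences *)

Lemma coin_pricesE n b : coin_prices n.+2 b =
  [:: coin_price 0 b, coin_price 1 b &
      [tuple coin_price t.+2 b | t < n]] :> seq (price R).
Proof. by rewrite /= 2!enum_ordSl /= -!map_comp. Qed.

(** Only time 0 admits a purchase and only time 1 a sale with revenue, so the first two actions
    decide the profit. *)
Lemma coin_profit n b (a : n.+2.-tuple action) :
    feasible n.+1 0 (coin_prices n.+2 b) a ->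
  profit (coin_prices n.+2 b) a =
  if nth Skip a 0 == Buy then
    (if (nth Skip a 1 == Sell) && b then 2 else 0) - 1
  else 0.
Proof.
move=> fa; rewrite /profit 2!big_ord_recl big1 => [|t _]; last first.
  (* From time 2 on, [Sell] and [Skip] earn 0, and [Buy] is infeasible at price [+oo]. *)
  rewrite tnth_mktuple (tnth_nth Skip).
  case E : (nth _ _ _) => //=.
  pose t' : 'I_n.+2 := lift ord0 (lift ord0 t).
  have lt_t : (t' < size (coin_prices n.+2 b))%N.
    by rewrite size_tuple.
  have := feasible_Buy (coin_price 0 b) fa lt_t E.
  by rewrite -tnth_nth tnth_mktuple.
rewrite !tnth_mktuple !(tnth_nth Skip) /= addr0.
move: fa; rewrite coin_pricesE.
(* Selling first from empty stock and buying at time 1 contradict feasibility. *)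
case/tupleP: a => -[] a; case/tupleP: a => -[] a //=; rewrite ?andbF// => _;
  by rewrite ?addr0 ?add0r// addrC.
Qed.

Lemma feasible_BuySell n b :
  feasible n.+1 0 (coin_prices n.+2 b)
    [tuple of [:: Buy, Sell & nseq n Skip]].
Proof.
rewrite coin_pricesE /=.
rewrite -[X in nseq X](size_tuple [tuple coin_price t.+2 b | t < n]).
exact: feasible_Skip.
Qed.

(** The singleton is a finite intersection of coordinate preimages of products of two singletons. *)
Lemma measurable_coin_prices T b : measurable [set coin_prices T b].
Proof.
have -> : [set coin_prices T b] =
    \bigcap_(t in [set: 'I_T]) ((@tnth T (price R) ^~ t) @^-1`
      ([set (coin_price t b).1] `*` [set (coin_price t b).2])).
  apply/seteqP; split => [_ -> t _|x xb] /=; first by rewrite tnth_mktuple.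
  apply: eq_from_tnth => t; rewrite tnth_mktuple.
  by apply/eqP; rewrite -pair_eqE; apply/andP; case: (xb t I) => /= -> ->.
apply: fin_bigcap_measurable => // t _; rewrite -[_ @^-1` _]setTI.
apply: measurable_tnth => //; apply: measurableX; last exact: measurable_set1.
exact: emeasurable_set1.
Qed.

Lemma coin_joint_set1 n b :
  coin_joint n.+2 [set coin_prices n.+2 b] = (2^-1)%:E.
Proof.
rewrite /coin_joint /distribution /pushforward.
transitivity (coin [set b]).
  congr (bernoulli_prob _ _); apply/seteqP; split => [b' /= E|_ -> //].
  (* The coin can be read off the sale price at time 1, as 2 differs from 0. *)
  have := congr1 (fun x => (tnth x (lift ord0 ord0)).2) E.
  rewrite !tnth_mktuple /=.
  by case: b b' {E} => -[] //= /eqP; rewrite ?pnatr_eq0 // eq_sym pnatr_eq0.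
rewrite coinE !diracE.
by rewrite !in_set1; case: b; rewrite /= ?mule1 ?mule0 ?adde0 ?add0e.
Qed.

(** With capacity [n.+1], the horizon [n.+2] leaves room for both trading times even at capacity
    1. *)
Definition coin_ATP n : ATP R :=
  @MkATP R n.+2 n.+1 0 (@coin_law n.+2) (coin_joint n.+2)
    isT isT isT (leqnSn _)
    (@coin_law_valid n.+2) (@coin_joint_indep n).

(** * Offline and online expected profit *)

Lemma coin_offline_gt0 n : (0 < offline_expected_profit (coin_ATP n))%E.
Proof.
rewrite /offline_expected_profit unlock.
(* This sequence has mass 1/2, and buying then selling earns 1 on it; elsewhere the maximum is at
   least its default 0. *)
pose D := [set coin_prices n.+2 true].
apply: (@lt_le_trans _ _ (\int[coin_joint n.+2]_x (\1_D x)%:E)%E).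
  rewrite integral_indicT; last exact: measurable_coin_prices.
  by rewrite [ltRHS]coin_joint_set1 lte_fin invr_gt0.
apply: ge0_le_integralT => x; rewrite lee_fin// indicE.
have [/set_mem -> /=|_] := boolP (x \in D); last exact: bigmax_ge_id.
apply: le_trans (le_bigmax_cond _ _ (feasible_BuySell n true)).
by rewrite (coin_profit (feasible_BuySell n true))/= lerBrDr lexx.
Qed.

(** The seeds that buy at time 0 are independent of the coin. On them the profit is at most 1 or at
    most -1 according to the coin, and the two events have equal mass. *)
Lemma coin_online_le0 n d (S : measurableType d) (mu : probability S R)
    (f : online_algorithm (coin_ATP n) S) :
  (online_expected_profit mu f <= 0)%E.
Proof.
rewrite /online_expected_profit unlock.
(* The price at time 0 is the same for both coin values, so [true] is an arbitrary choice. *)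
pose buys u := @decide _ _ _ _ f 0 u [tuple coin_price 0 true] [tuple] == Buy.
pose A := [set u | buys u].
have mA : measurable A.
  have mBuy := @decide_measurable _ _ _ _ f 0 [tuple] Buy isT.
  (* Fixing the observed price gives a section of the measurable decision set. *)
  have := measurable_ysection [tuple coin_price 0 true] mBuy.
  rewrite [X in measurable X](_ : _ = A)//.
  by apply/seteqP; split => u; rewrite /ysection/= inE => /eqP.
pose x := coin_prices n.+2.
have mx b : measurable [set x b] by exact: measurable_coin_prices.
(* Price sequences that almost surely do not occur, where the profit is not controlled. *)
pose N := [set: S] `*` ~` (range x).
have mN : measurable (~` (range x)).
  apply: measurableC; rewrite (_ : range x = [set x true] `|` [set x false]).
    by apply: measurableU; exact: mx.
  apply/seteqP; split => [_ [[] _ <-]|_ [] ->].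
  - by left.
  - by right.
  - by exists true.
  - by exists false.
have N0 : coin_joint n.+2 (~` (range x)) = 0%E.
  rewrite /coin_joint /= /distribution /pushforward -(measure0 coin).
  congr (bernoulli_prob _ _); apply/seteqP; split => // b /=.
  by apply; exists b.
have Ax b : (mu \x coin_joint n.+2)%E (A `*` [set x b]) = (mu A * (2^-1)%:E)%E.
  by rewrite product_measure1E//; congr (_ * _)%E; exact: coin_joint_set1.
have run_le u b : (profit (x b) (run f u (x b)) <=
    if buys u then (if b then 1 else -1) else 0)%R.
  have := @decide_feasible _ _ _ _ f u (x b).
  move=> /(_ _)/coin_profit ->; last first.
    by move=> t; rewrite tnth_mktuple; exact: coin_price_valid.
  rewrite /run /= nth_play//.
  rewrite (_ : [tuple _ | _ < _] = [tuple coin_price 0 true]); last first.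
    apply: eq_from_tnth => t; rewrite tnth_mktuple ord1.
    by rewrite coin_pricesE.
  rewrite -/(buys u); case: ifP => // _; case: b; rewrite ?andbF ?sub0r //.
  by case: ifP; rewrite lerBlDr ?add0r -?natrD ?ler0n ?lexx.
pose m b := (mu \x coin_joint n.+2)%E (A `*` [set x b]).
apply: (@le_trans _ _ (m true - m false)%E); last first.
  by rewrite /m !Ax subee// fin_numM// fin_num_measure.
apply: (@integral_le_measureB _ _ _ _ _ _ _ N).
- exact: measurableX.
- exact: measurableX.
- exact: measurableX.
- apply: etrans (product_measure1E _ _ measurableT mN) _.
  by rewrite [X in (_ * X)%E]N0 mule0.
- move=> [u y] /set_mem[/= uA ->]; rewrite lee_fin (le_trans (run_le _ _))//.
  by rewrite uA.
- move=> [u y] /set_mem[/= uA ->]; rewrite lee_fin (le_trans (run_le _ _))//.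
  by rewrite uA.
(* Outside the three sets, the prices are some [x b] and the seed does not buy, so the profit is at
   most 0. *)
- move=> [u y] /= /negP C /negP D /negP N'.
  have [b _ yE] : range x y.
    by apply: contrapT => h; apply: N'; apply: mem_set; split.
  rewrite -yE lee_fin (le_trans (run_le _ _))//; case: ifPn => // uA.
  by case: b yE C D => <- C D; [case: C|case: D]; apply: mem_set; split.
Qed.

End instance.

Theorem theorem1p1 (R : realType) (B : nat) (hB : (1 <= B)%N) :
  exists I : ATP R,
    [/\ capacity I = B,
        stock0 I = 0%N,
        (0 < offline_expected_profit I)%E
      & forall (d : measure_display) (S : measurableType d)
          (mu : probability S R) (f : online_algorithm I S),
          ~ (0 < online_expected_profit mu f)%E].
Proof.
case: B hB => // n _; exists (coin_ATP R n); split => //.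
  exact: coin_offline_gt0.
by move=> d S mu f; apply/negP; rewrite -leNgt; exact: coin_online_le0.
Qed.
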